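(* Let $(X,d)$ be a complete $b$-metric space with constant $s\in[1,\infty)$ and let $T:X\to\mathcal{B}(X)$ be a function such that: (i) the $b$-metric $d$ is $\ast$-continuous; (ii) there exist $c,\delta\in[0,1]$ and $\alpha\in[0,1)$ such that $h(T(x),T(y))\le\alpha N_{c,\delta}(x,y)$ for all $x,y\in X$; (iii) $\alpha\delta s<1$ (for the constants $\alpha,\delta$ of (ii)). Then $T$ has a fixed point, i.e. there exists $u\in X$ with $u\in T(u)$.
   Context: Given a nonempty set $X$ and a real number $s\in[1,\infty)$, a function $d:X\times X\to[0,\infty)$ is called a $b$-metric (with constant $s$) if for all $x,y,z\in X$: (i) $d(x,y)=0$ if and only if $x=y$; (ii) $d(x,y)=d(y,x)$; (iii) $d(x,y)\le s(d(x,z)+d(z,y))$. The pair $(X,d)$ is called a $b$-metric space. A sequence $(x_n)_{n\in\mathbb{N}}$ in $X$ is convergent to $l\in X$ (written $\lim_{n\to\infty}x_n=l$) if $\lim_{n\to\infty}d(x_n,l)=0$; it is Cauchy if for every $\varepsilon>0$ there exists $n_\varepsilon\in\mathbb{N}$ such that $d(x_m,x_n)<\varepsilon$ for all $m,n\ge n_\varepsilon$. $(X,d)$ is complete if every Cauchy sequence is convergent. The space carries the topology induced by this convergence: a subset is closed if it contains the limit of each convergent sequence of its elements. $\mathcal{B}(X)$ denotes the set of non-empty bounded closed subsets of $X$ (bounded meaning that $d$ is bounded on pairs of elements of the subset). For $x\in X$ and $C\in\mathcal{B}(X)$, $d(x,C)=\inf_{c\in C}d(x,c)$. For $A,B\in\mathcal{B}(X)$,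 $h(A,B)=\max\{\sup_{a\in A}d(a,B),\ \sup_{b\in B}d(b,A)\}$. For constants $c,\delta\in[0,1]$ and $x,y\in X$, $$N_{c,\delta}(x,y)=\max\Big\{d(x,y),\ c\,d(x,T(x)),\ c\,d(y,T(y)),\ \tfrac{\delta}{2}\big(d(x,T(y))+d(y,T(x))\big)\Big\}.$$ The $b$-metric $d$ is called $\ast$-continuous if for every $A\in\mathcal{B}(X)$, every $x\in X$ and every sequence $(x_n)_{n\in\mathbb{N}}$ in $X$ with $\lim_{n\to\infty}x_n=x$, one has $\lim_{n\to\infty}d(x_n,A)=d(x,A)$. *)

(* Defs.v *)
From mathcomp Require Import all_boot all_order all_algebra.
From mathcomp Require Import all_classical all_reals all_analysis.

Set Implicit Arguments.
Unset Strict Implicit.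
Unset Printing Implicit Defensive.

Import Order.TTheory GRing.Theory Num.Theory.
Import numFieldNormedType.Exports.

Local Open Scope classical_set_scope.
Local Open Scope ring_scope.

(* [X] is a bare type: its convergence and closed sets are those defined
   below from [d], not those of a library topology. *)

Definition b_metric (R : realType) (X : Type) (s : R) (d : X -> X -> R) : Prop :=
  [/\ 1 <= s,
      forall x y, 0 <= d x y,
      forall x y, d x y = 0 <-> x = y,
      forall x y, d x y = d y x &
      forall x y z, d x y <= s * (d x z + d z y)].

Definition b_cvg (R : realType) (X : Type) (d : X -> X -> R)
    (x_ : nat -> X) (l : X) : Prop :=
  (fun n => d (x_ n) l) @ \oo --> (0 : R).

Definition b_cauchy (R : realType) (X : Type) (d : X -> X -> R)
    (x_ : nat -> X) : Prop :=
  forall e : R, 0 < e -> exists n0 : nat, forall m n : nat,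
    (n0 <= m)%N -> (n0 <= n)%N -> d (x_ m) (x_ n) < e.

Definition b_complete (R : realType) (X : Type) (d : X -> X -> R) : Prop :=
  forall x_ : nat -> X, b_cauchy d x_ -> exists l : X, b_cvg d x_ l.

Definition b_closed (R : realType) (X : Type) (d : X -> X -> R)
    (A : set X) : Prop :=
  forall (x_ : nat -> X) (l : X),
    (forall n, A (x_ n)) -> b_cvg d x_ l -> A l.

Definition b_bounded (R : realType) (X : Type) (d : X -> X -> R)
    (A : set X) : Prop :=
  exists M : R, forall x y, A x -> A y -> d x y <= M.

Definition bounded_closed_sets (R : realType) (X : Type) (d : X -> X -> R) :
    set (set X) :=
  [set A | [/\ A !=set0, b_bounded d A & b_closed d A]].

(* For a b-metric [d] and members of [bounded_closed_sets d], the [inf] here and the [sup]s in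
   [hausdorff_dist] are taken over nonempty sets of reals bounded on the
   relevant side, so the default values of [inf] and [sup] never arise. *)
Definition dist_set (R : realType) (X : Type) (d : X -> X -> R)
    (x : X) (C : set X) : R :=
  inf [set d x c | c in C].

Definition hausdorff_dist (R : realType) (X : Type) (d : X -> X -> R)
    (A B : set X) : R :=
  Num.max (sup [set dist_set d a B | a in A])
          (sup [set dist_set d b A | b in B]).

Definition N_max (R : realType) (X : Type) (d : X -> X -> R)
    (T : X -> set X) (c delta : R) (x y : X) : R :=
  Num.max (d x y)
    (Num.max (c * dist_set d x (T x))
      (Num.max (c * dist_set d y (T y))
        (delta / 2 * (dist_set d x (T y) + dist_set d y (T x))))).

Definition star_continuous (R : realType) (X : Type) (d : X -> X -> R) : Prop :=
  forall (A : set X) (x : X) (x_ : nat -> X),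
    bounded_closed_sets d A -> b_cvg d x_ x ->
    (fun n => dist_set d (x_ n) A) @ \oo --> dist_set d x A.

(* Main.v *)
Require Import Defs.
From mathcomp Require Import all_boot all_order all_algebra.
From mathcomp Require Import all_classical all_reals all_analysis.
From mathcomp Require Import lra.

Set Implicit Arguments.
Unset Strict Implicit.
Unset Printing Implicit Defensive.

Import Order.TTheory GRing.Theory Num.Theory.
Import numFieldNormedType.Exports.

Local Open Scope classical_set_scope.
Local Open Scope ring_scope.

(** Why the theorem holds.

    If [y] lies in [T x], the contraction condition bounds [d(y, T y)] by
    [alpha * N(x, y)], and every entry of that maximum is controlled by
    [r = d x y] and [D = d(y, T y)]: the point-to-set distances give
    [d(x, T x) <= r], [d(y, T x) = 0] and [d(x, T y) <= s * (r + D)].  Hence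
    [D <= alpha * r], or [D <= alpha * D], or
    [D <= (alpha * delta * s) * (r + D) / 2], and in each case
    [D <= max(alpha, alpha * delta * s) * r] with a ratio below [1]
    ([dist_set_image_contraction]).

    Suppose now that [T] has no fixed point.  Then [r > 0] whenever [y] lies in
    [T x], so the infimum defining [D] can be approximated by a point of [T y]
    at the cost of a slightly larger ratio [q < 1], and iterating gives an orbit
    [x_(n+1)] in [T x_n] whose steps decay like [q ^ n]
    ([geometric_orbit]).  In a b-metric space such an orbit is Cauchy even when
    [s * q >= 1] ([geometric_b_cauchy]): one compares points [p] indices apart,
    where [p] is so large that [s * q ^ p < 1].

    Let [u] be its limit and [L = d(u, T u)].  In
    [d(x_(n+1), T u) <= alpha * N(x_n, u)] the left side tends to [L] by
    star-continuity, while [N(x_n, u)] is at most [L] plus quantities tending to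
    [0] ([orbit_limit_dist]).  So [L <= alpha * L], that is [L = 0], and [u]
    lies in the closed set [T u], a contradiction. *)

(** * Distance from a point to a set *)

Lemma dist_set_lbound (R : realType) (X : Type) (d : X -> X -> R) (x : X)
    (C : set X) :
  (forall x y, 0 <= d x y) -> lbound [set d x c | c in C] 0.
Proof. by move=> d0 _ [c _ <-]. Qed.

Lemma dist_set_le (R : realType) (X : Type) (d : X -> X -> R) (x y : X)
    (C : set X) :
  (forall x y, 0 <= d x y) -> C y -> dist_set d x C <= d x y.
Proof.
move=> d0 Cy; apply: ge_inf; last by exists y.
by exists 0; exact: dist_set_lbound.
Qed.

Lemma dist_set_ge0 (R : realType) (X : Type) (d : X -> X -> R) (x : X)
    (C : set X) :
  (forall x y, 0 <= d x y) -> C !=set0 -> 0 <= dist_set d x C.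
Proof.
move=> d0 [y Cy]; apply: lb_le_inf; first by exists (d x y), y.
exact: dist_set_lbound.
Qed.

Lemma dist_set_approx (R : realType) (X : Type) (d : X -> X -> R) (x : X)
    (C : set X) (r : R) :
  C !=set0 -> dist_set d x C < r -> exists2 y, C y & d x y < r.
Proof.
move=> [y Cy] /(inf_lt _)[|_ [z Cz <-] zr]; last by exists z.
by exists (d x y), y.
Qed.

Lemma dist_set_triangle (R : realType) (X : Type) (s : R) (d : X -> X -> R)
    (x y : X) (C : set X) :
  b_metric s d -> C !=set0 ->
  dist_set d x C <= s * (d x y + dist_set d y C).
Proof.
move=> [s1 d0 _ _ dtri] C0; have s0 : 0 < s by lra.
rewrite -ler_pdivrMl// -lerBlDl; apply: lb_le_inf.
  by case: C0 => z Cz; exists (d y z), z.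
move=> _ [z Cz <-]; rewrite lerBlDl ler_pdivrMl//.
exact: le_trans (dist_set_le _ d0 Cz) (dtri x z y).
Qed.

Lemma dist_set_eq0 (R : realType) (X : Type) (s : R) (d : X -> X -> R)
    (x : X) (C : set X) :
  b_metric s d -> bounded_closed_sets d C -> dist_set d x C = 0 -> C x.
Proof.
move=> [_ d0 _ dsym _] [C0 _ Ccl] xC0.
have /choice[y_ Hy] n : exists y, C y /\ d x y < n.+1%:R^-1.
  by have [|y Cy yn] := @dist_set_approx _ _ d x C n.+1%:R^-1 C0;
    [rewrite xC0 invr_gt0 | exists y].
apply: (Ccl y_) => [n|]; first by case: (Hy n).
apply: (@squeeze_cvgr _ _ _ _ (fun=> 0) harmonic).
- by apply: nearW => n; rewrite d0 dsym ltW//; case: (Hy n).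
- exact: cvg_cst.
- exact: cvg_harmonic.
Qed.

(** Boundedness of [A] is what makes the supremum in [hausdorff_dist] a genuine
    upper bound. *)
Lemma dist_set_le_hausdorff (R : realType) (X : Type) (s : R)
    (d : X -> X -> R) (A B : set X) (a : X) :
  b_metric s d -> b_bounded d A -> B !=set0 -> A a ->
  dist_set d a B <= hausdorff_dist d A B.
Proof.
move=> [s1 d0 _ _ dtri] [M AM] [b Bb] Aa.
rewrite /hausdorff_dist le_max; apply/orP; left.
apply: ub_le_sup; last by exists a.
exists (s * (M + d a b)) => _ [x Ax <-].
apply: (le_trans (dist_set_le _ d0 Bb)); apply: (le_trans (dtri x b a)).
by rewrite ler_wpM2l ?lerD2r ?AM//; lra.
Qed.

(** * Sequences with geometrically decaying steps *)

Lemma geometric_bounded_gap (R : realType) (X : Type) (s q K : R)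
    (d : X -> X -> R) (x_ : nat -> X) (p : nat) :
  b_metric s d -> 0 <= q <= 1 -> 0 <= K ->
  (forall n, d (x_ n) (x_ n.+1) <= K * q ^+ n) ->
  exists2 C : R, 0 <= C &
    forall k n, (k <= p)%N -> d (x_ n) (x_ (n + k)%N) <= C * q ^+ n.
Proof.
move=> [s1 d0 deq dsym dtri] /andP[q0 q1] K0 step.
elim: p => [|p [C C0 IH]].
  exists 0 => // k n; rewrite leqn0 => /eqP->.
  by rewrite addn0 mul0r; have [_ ->] := deq (x_ n) (x_ n).
have sKC : 0 <= s * (K + C) by rewrite mulr_ge0; lra.
exists (s * (K + C)) => // -[|k] n kp.
  rewrite addn0; have [_ ->//] := deq (x_ n) (x_ n).
  by rewrite mulr_ge0// exprn_ge0.
have s0 : 0 <= s by lra.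
apply: (le_trans (dtri _ _ (x_ n.+1))).
rewrite -mulrA ler_wpM2l ?mulrDl//.
apply: lerD => //; rewrite addnS -addSn.
apply: (le_trans (IH k n.+1 kp)).
by rewrite ler_wpM2l// exprS ler_piMl// exprn_ge0.
Qed.

(** Each application of the b-triangle inequality costs a factor [s], so summing
    the steps one by one would need [s * q < 1].  Jumping [p] indices at a time
    the recursion is [K' = s * C + (s * q ^+ p) * K'], solvable
    once [s * q ^+ p < 1]. *)
Lemma geometric_tail_bound (R : realType) (X : Type) (s q K : R)
    (d : X -> X -> R) (x_ : nat -> X) :
  b_metric s d -> 0 <= q < 1 -> 0 <= K ->
  (forall n, d (x_ n) (x_ n.+1) <= K * q ^+ n) ->
  exists2 B : R, 0 <= B & forall k n, d (x_ n) (x_ (n + k)%N) <= B * q ^+ n.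
Proof.
move=> dm /andP[q0 q1] K0 step; have [s1 d0 _ _ dtri] := dm.
have s0 : 0 < s by lra.
have [p p0 sqp] : exists2 p, (0 < p)%N & s * q ^+ p < 1.
  have := @cvg_expr R q; rewrite ger0_norm// => /(_ q1).
  move=> /cvgr0_norm_lt /(_ s^-1); rewrite invr_gt0 => /(_ s0)[N _ HN].
  exists N.+1 => //; have := HN N.+1 (leqnSn N).
  rewrite /= ger0_norm ?exprn_ge0// => qN.
  by rewrite -(mulfV (lt0r_neq0 s0)) ltr_pM2l.
have q01 : 0 <= q <= 1 by rewrite q0 ltW.
have [C C0 HC] := geometric_bounded_gap p dm q01 K0 step.
pose w := 1 - s * q ^+ p.
have w0 : 0 < w by rewrite /w; lra.
pose B := s * C / w.
have B0 : 0 <= B by rewrite /B divr_ge0 ?mulr_ge0; lra.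
have BE : s * C + s * q ^+ p * B = B.
  have /eqP : B * w = s * C by rewrite /B divfK// lt0r_neq0.
  by rewrite /w => /eqP; lra.
have CB : C <= B.
  have : C <= s * C by rewrite ler_peMl.
  have : 0 <= s * q ^+ p * B by rewrite mulr_ge0// mulr_ge0 ?exprn_ge0// ltW.
  lra.
exists B => // k; elim/ltn_ind: k => k IH n.
have [kp|pk] := leqP k p.
  by apply: (le_trans (HC _ _ kp)); rewrite ler_wpM2r// exprn_ge0.
apply: (le_trans (dtri _ _ (x_ (n + p)%N))).
have -> : (n + k = (n + p) + (k - p))%N by rewrite -addnA subnKC// ltnW.
have kpk : (k - p < k)%N by rewrite ltn_subrL p0 (ltn_trans p0).
have := IH _ kpk (n + p)%N; have := HC p n (leqnn p) => H1 H2.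
apply: (@le_trans _ _ (s * (C * q ^+ n + B * q ^+ (n + p)))).
  by rewrite ler_wpM2l ?lerD// ltW.
rewrite -[in leRHS]BE exprD; lra.
Qed.

Lemma geometric_b_cauchy (R : realType) (X : Type) (s q K : R)
    (d : X -> X -> R) (x_ : nat -> X) :
  b_metric s d -> 0 <= q < 1 -> 0 <= K ->
  (forall n, d (x_ n) (x_ n.+1) <= K * q ^+ n) -> b_cauchy d x_.
Proof.
move=> dm q01 K0 step e e0.
have [B B0 HB] := geometric_tail_bound dm q01 K0 step.
have [_ _ _ dsym _] := dm; case/andP: (q01) => q0 q1.
have := @cvg_expr R q; rewrite ger0_norm// => /(_ q1).
move=> /cvgr0_norm_lt /(_ (e / (B + 1))).
case=> [|N _ HN]; first by rewrite divr_gt0//; lra.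
exists N.
have main m n : (N <= m)%N -> (m <= n)%N -> d (x_ m) (x_ n) < e.
  move=> Nm mn; rewrite -(subnKC mn); apply: (le_lt_trans (HB _ _)).
  have := HN m Nm; rewrite /= ger0_norm ?exprn_ge0// ltr_pdivlMr; last lra.
  have := exprn_ge0 m q0; lra.
move=> m n Nm Nn; have [mn|nm] := leqP m n; first exact: main.
by rewrite dsym main// ltnW.
Qed.

(** * The contraction *)

(** Here [r], [D] stand for [d x y] and [d(y, T y)]; [e1], [e2], [e3] for the
    other distances entering [N_max]. *)
Lemma contraction_ratio (R : realType) (s c delta alpha r D e1 e2 e3 : R) :
  0 <= c <= 1 -> 0 <= delta -> 0 <= alpha < 1 -> 1 <= s ->
  alpha * delta * s < 1 ->
  0 <= r -> 0 <= D -> 0 <= e1 -> e1 <= r -> e2 <= s * (r + D) -> e3 <= 0 ->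
  D <= alpha * Num.max r (Num.max (c * e1)
         (Num.max (c * D) (delta / 2 * (e2 + e3)))) ->
  D <= Num.max alpha (alpha * delta * s) * r.
Proof.
move=> /andP[c0 c1] dl0 /andP[a0 a1] s1 k1 r0 D0 e10 e1r e2r e30.
rewrite maxr_pMl// le_max !maxr_pMr//.
have ce1 : c * e1 <= r by apply: le_trans e1r; rewrite ler_piMl.
have cD : c * D <= D by rewrite ler_piMl.
have ace1 : alpha * (c * e1) <= alpha * r by rewrite ler_wpM2l.
have acD : alpha * (c * D) <= alpha * D by rewrite ler_wpM2l.
have k0 : 0 <= alpha * delta * s by rewrite !mulr_ge0//; lra.
have Na : alpha * (delta / 2 * (e2 + e3)) <= alpha * delta * s * ((r + D) / 2).
  have : alpha * delta * (e2 + e3) <= alpha * delta * (s * (r + D)).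
    by rewrite ler_wpM2l ?mulr_ge0//; lra.
  lra.
have ar : 0 <= alpha * r by rewrite mulr_ge0.
rewrite !le_max => /orP[->//|/orP[|/orP[|]]] H.
- by rewrite (le_trans H).
(* a point with [D <= alpha * D] is at distance 0 *)
- suff : D = 0 by move=> ->; rewrite ar.
  have : (1 - alpha) * D <= 0 by lra.
  by rewrite pmulr_rle0; lra.
- apply/orP; right; have {H Na} H := le_trans H Na.
  set k := alpha * delta * s in k0 k1 H *.
  (* [D] is at most the mean of [r] and [D], shrunk by [k <= 1] *)
  have Dr : D <= r.
    rewrite leNgt; apply/negP => rD.
    have : k * ((r + D) / 2) <= 1 * ((r + D) / 2).
      by rewrite ler_wpM2r ?ltW//; lra.
    lra.
  have : k * ((r + D) / 2) <= k * r by rewrite ler_wpM2l//; lra.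
  lra.
Qed.

Lemma dist_set_image_contraction (R : realType) (X : Type) (s : R)
    (d : X -> X -> R) (T : X -> set X) (c delta alpha : R) (x y : X) :
  b_metric s d ->
  (forall x, bounded_closed_sets d (T x)) ->
  0 <= c <= 1 -> 0 <= delta <= 1 -> 0 <= alpha < 1 ->
  (forall x y, hausdorff_dist d (T x) (T y) <= alpha * N_max d T c delta x y) ->
  alpha * delta * s < 1 ->
  T x y ->
  dist_set d y (T y) <= Num.max alpha (alpha * delta * s) * d x y.
Proof.
move=> dm Tbc c01 /andP[dl0 _] a01 hN k1 Txy.
have [s1 d0 deq _ _] := dm.
have [Tx0 Txb _] := Tbc x; have [Ty0 _ _] := Tbc y.
apply: (@contraction_ratio _ s c delta alpha (d x y) _ (dist_set d x (T x))
  (dist_set d x (T y)) (dist_set d y (T x))) => //.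
- exact: dist_set_ge0.
- exact: dist_set_ge0.
- exact: dist_set_le.
- exact: dist_set_triangle.
- by have [_ <-//] := deq y y; exact: dist_set_le.
- exact: le_trans (dist_set_le_hausdorff dm Txb Ty0 Txy) (hN x y).
Qed.

(** The absence of fixed points makes every step [d x y] positive, which leaves
    room between [q0 * d x y] and [q * d x y] to approximate the infimum. *)
Lemma geometric_orbit (R : realType) (X : Type) (s : R) (d : X -> X -> R)
    (T : X -> set X) (q0 q : R) :
  [set: X] !=set0 ->
  b_metric s d ->
  (forall x, T x !=set0) -> (forall x, ~ T x x) ->
  0 <= q0 < q ->
  (forall x y, T x y -> dist_set d y (T y) <= q0 * d x y) ->
  exists2 x_ : nat -> X, forall n, T (x_ n) (x_ n.+1) &
    forall n, d (x_ n) (x_ n.+1) <= d (x_ 0%N) (x_ 1%N) * q ^+ n.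
Proof.
move=> [a _] [_ d0 deq _ _] T0 Tfix /andP[q00 q0q] contr.
have /choice[f Hf] (p : X * X) : exists z,
    T p.1 p.2 -> T p.2 z /\ d p.2 z <= q * d p.1 p.2.
  have [Tp|nTp] := pselect (T p.1 p.2); last by exists a.
  have dp : 0 < d p.1 p.2.
    rewrite lt_neqAle d0 andbT eq_sym; apply/eqP => /deq E.
    by apply: (Tfix p.2); rewrite -[X in T X]E.
  have [|z Tz zq] := @dist_set_approx _ _ d p.2 _ (q * d p.1 p.2) (T0 p.2).
    by rewrite (le_lt_trans (contr _ _ Tp))// ltr_pM2r.
  by exists z => _; split=> //; exact: ltW.
have [b Tab] := T0 a.
(* the orbit is built together with its shift, since a step depends on the
   two preceding points *)
pose w n := iter n (fun p => (p.2, f p)) (a, b).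
have Tw n : T (w n).1 (w n).2.
  by elim: n => [//|n IH]; have [] := Hf (w n) IH.
exists (fun n => (w n).1) => [n|]; first exact: Tw.
elim=> [|n IH]; first by rewrite expr0 mulr1.
have [_ /le_trans] := Hf (w n) (Tw n); apply.
rewrite exprS mulrCA ler_wpM2l//; lra.
Qed.

(** * The limit of an orbit *)

Lemma orbit_limit_dist (R : realType) (X : Type) (s : R) (d : X -> X -> R)
    (T : X -> set X) (c delta alpha : R) (x_ : nat -> X) (u : X) :
  b_metric s d ->
  (forall x, bounded_closed_sets d (T x)) ->
  star_continuous d ->
  0 <= c <= 1 -> 0 <= delta <= 1 -> 0 <= alpha ->
  (forall x y, hausdorff_dist d (T x) (T y) <= alpha * N_max d T c delta x y) ->
  (forall n, T (x_ n) (x_ n.+1)) -> b_cvg d x_ u ->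
  dist_set d u (T u) <= alpha * dist_set d u (T u).
Proof.
move=> dm Tbc dstar /andP[c0 c1] /andP[dl0 dl1] a0 hN orb xu.
have [s1 d0 _ dsym dtri] := dm.
have Tne x : T x !=set0 by case: (Tbc x).
have Tbd x : b_bounded d (T x) by case: (Tbc x).
set L := dist_set d u (T u).
have L0 : 0 <= L by exact: dist_set_ge0.
have xTu : (fun n => dist_set d (x_ n) (T u)) @ \oo --> L by exact: dstar.
have xu1 : (fun n => d (x_ n.+1) u) @ \oo --> 0.
  by rewrite (cvg_shiftS (fun n => d (x_ n) u)).
have xTu1 : (fun n => dist_set d (x_ n.+1) (T u)) @ \oo --> L.
  by rewrite (cvg_shiftS (fun n => dist_set d (x_ n) (T u))).
(* [g] dominates [N_max] at [x_ n] and [u] and has the same limit [L] *)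
pose g n := L + (s + 1) * (d (x_ n) u + d (x_ n.+1) u)
            + `|dist_set d (x_ n) (T u) - L|.
have gL : g @ \oo --> L.
  have -> : L = L + (s + 1) * (0 + 0) + `|L - L|.
    by rewrite subrr normr0 !addr0 mulr0 addr0.
  apply: cvgD.
    by apply: cvgD; [exact: cvg_cst|apply: cvgM; [exact: cvg_cst|exact: cvgD]].
  by apply: cvg_norm; apply: cvgB => //; exact: cvg_cst.
have agL : (fun n => alpha * g n) @ \oo --> alpha * L.
  by apply: cvgM => //; exact: cvg_cst.
apply: (ler_cvg_to xTu1 agL); apply: nearW => n /=.
apply: (le_trans (dist_set_le_hausdorff dm (Tbd _) (Tne _) (orb n))).
apply: (le_trans (hN _ _)); rewrite ler_wpM2l// /N_max.
have A0 := d0 (x_ n) u; have A1 := d0 (x_ n.+1) u.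
have sA0 : 0 <= s * d (x_ n) u by rewrite mulr_ge0//; lra.
have sA1 : 0 <= s * d (x_ n.+1) u by rewrite mulr_ge0//; lra.
have N0 := normr_ge0 (dist_set d (x_ n) (T u) - L).
have N1 := ler_norm (dist_set d (x_ n) (T u) - L).
have D0 : 0 <= dist_set d (x_ n) (T u) by exact: dist_set_ge0.
have step : dist_set d (x_ n) (T (x_ n)) <= s * (d (x_ n) u + d (x_ n.+1) u).
  apply: (le_trans (dist_set_le _ d0 (orb n))).
  by rewrite (dsym (x_ n.+1) u); exact: dtri.
have cstep : c * dist_set d (x_ n) (T (x_ n)) <= dist_set d (x_ n) (T (x_ n)).
  by rewrite ler_piMl// dist_set_ge0.
have cL : c * L <= L by rewrite ler_piMl.
have uT : dist_set d u (T (x_ n)) <= d (x_ n.+1) u.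
  by rewrite dsym; exact: dist_set_le.
have U0 : 0 <= dist_set d u (T (x_ n)) by exact: dist_set_ge0.
have mid : delta / 2 * (dist_set d (x_ n) (T u) + dist_set d u (T (x_ n)))
           <= dist_set d (x_ n) (T u) + dist_set d u (T (x_ n)).
  by rewrite ler_piMl//; lra.
by rewrite /g !ge_max; apply/and4P; split; lra.
Qed.

Theorem theorem3p2 (R : realType) (X : Type) (s : R) (d : X -> X -> R)
    (T : X -> set X) (c delta alpha : R) :
  [set: X] !=set0 ->
  b_metric s d ->
  b_complete d ->
  (forall x, bounded_closed_sets d (T x)) ->
  star_continuous d ->
  0 <= c <= 1 -> 0 <= delta <= 1 -> 0 <= alpha < 1 ->
  (forall x y, hausdorff_dist d (T x) (T y) <= alpha * N_max d T c delta x y) ->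
  alpha * delta * s < 1 ->
  exists u : X, T u u.
Proof.
move=> X0 dm dcomp Tbc dstar c01 dl01 a01 hN k1.
have [_ d0 _ _ _] := dm.
have Tne x : T x !=set0 by case: (Tbc x).
apply: contrapT => /forallNP Tfix.
pose q0 := Num.max alpha (alpha * delta * s).
have /andP[a0 a1] := a01.
have q00 : 0 <= q0 by rewrite le_max a0.
have q01 : q0 < 1 by rewrite gt_max a1.
have q0q : 0 <= q0 < (q0 + 1) / 2 by rewrite q00; lra.
have contr x y : T x y -> dist_set d y (T y) <= q0 * d x y.
  exact: (dist_set_image_contraction dm Tbc c01 dl01 a01 hN k1).
have [x_ orb step] := geometric_orbit X0 dm Tne Tfix q0q contr.
have /dcomp[u xu] : b_cauchy d x_.
  by apply: (geometric_b_cauchy dm _ (d0 (x_ 0%N) (x_ 1%N)) step); lra.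
apply: (Tfix u); apply: (dist_set_eq0 dm (Tbc u)).
have := orbit_limit_dist dm Tbc dstar c01 dl01 a0 hN orb xu.
set L := dist_set d u (T u) => LaL.
apply/eqP; rewrite eq_le dist_set_ge0// andbT.
by rewrite -(@pmulr_rle0 _ (1 - alpha)); lra.
Qed.
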